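(* The unitary group $U(3)$ satisfies $$U(3)=\{\operatorname{diag}(\lambda_1,\lambda_2,\lambda_3)\,X_\beta Y^z_\alpha X_\gamma\,\operatorname{diag}(1,\lambda_4,\lambda_5):\ \alpha,\beta,\gamma\in[0,2\pi];\ z,\lambda_1,\dots,\lambda_5\in\mathbb{T}\}$$ $$=\{\operatorname{diag}(\lambda_1,\lambda_2,\lambda_3)\,Z_\beta Y^z_\alpha X_\gamma\,\operatorname{diag}(1,\lambda_4,\lambda_5):\ \alpha,\beta,\gamma\in[0,2\pi];\ z,\lambda_1,\dots,\lambda_5\in\mathbb{T}\},$$ where for $\varphi\in[0,2\pi]$ and $z\in\mathbb{T}$ $$X_\varphi=\begin{bmatrix}1&0&0\\0&\cos\varphi&-\sin\varphi\\0&\sin\varphi&\cos\varphi\end{bmatrix},\quad Y^z_\varphi=\begin{bmatrix}\cos\varphi&0&-\sin\varphi\\0&z&0\\\sin\varphi&0&\cos\varphi\end{bmatrix},\quad Z_\varphi=\begin{bmatrix}\cos\varphi&-\sin\varphi&0\\\sin\varphi&\cos\varphi&0\\0&0&1\end{bmatrix}.$$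
   Context: $\mathbb{T}=\{z\in\mathbb{C}:|z|=1\}$. *)

(* Defs.v *)
From HB Require Import structures.
From mathcomp Require Import all_boot all_order all_algebra.
From mathcomp Require Import spectral complex.
From mathcomp Require Import all_classical all_reals all_analysis.

Set Implicit Arguments.
Unset Strict Implicit.
Unset Printing Implicit Defensive.

Import Order.TTheory GRing.Theory Num.Theory.

Local Open Scope classical_set_scope.
Local Open Scope ring_scope.
Local Open Scope complex_scope.

Definition mx3 (K : nzRingType) (rows : seq (seq K)) : 'M[K]_3 :=
  \matrix_(i < 3, j < 3) (nth [::] rows i)`_j.

Definition diag3 (K : nzRingType) (a b c : K) : 'M[K]_3 :=
  diag_mx (\row_(j < 3) [:: a; b; c]`_j).

Definition circle (R : realType) : set R[i] := [set z | `|z| = 1].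
Arguments circle : clear implicits.

Definition unitary_group (R : realType) (n : nat) : set 'M[R[i]]_n :=
  [set A | A \is unitarymx].
Arguments unitary_group : clear implicits.

Definition rotX (R : realType) (phi : R) : 'M[R[i]]_3 :=
  mx3 [:: [:: 1;           0;               0];
          [:: 0; (cos phi)%:C; - (sin phi)%:C];
          [:: 0; (sin phi)%:C;   (cos phi)%:C]].

Definition rotY (R : realType) (z : R[i]) (phi : R) : 'M[R[i]]_3 :=
  mx3 [:: [:: (cos phi)%:C; 0; - (sin phi)%:C];
          [::            0; z;              0];
          [:: (sin phi)%:C; 0;   (cos phi)%:C]].

Definition rotZ (R : realType) (phi : R) : 'M[R[i]]_3 :=
  mx3 [:: [:: (cos phi)%:C; - (sin phi)%:C; 0];
          [:: (sin phi)%:C;   (cos phi)%:C; 0];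
          [::            0;              0; 1]].

(* Main.v *)
(** Choosing phases and angles, write the first row of a unitary [U] as
[(l1 cos a, - l1 l4 sin a sin g, - l1 l5 sin a cos g)] and its first column as
[(l1 cos a, - l2 sin a sin b, l3 sin a cos b)].  Stripping the outer phases and
the rotations [X_b], [X_g] from [U] leaves a unitary matrix with first row
[(cos a, 0, - sin a)] and first column [(cos a, 0, sin a)]; if [sin a != 0],
orthogonality of its rows and columns forces it to be [Y^z_a].  If [sin a = 0],
one rotates the second column to the second basis vector instead.
The factorization with [Z_b] follows by swapping the first and third rows:
this swap [S] turns [X_b] into [Z_(-b)], and [S Y^z_a] is
[Y^z_(pi/2 - a) diag(1, 1, -1)]. *)
Require Import Defs.
From mathcomp Require Import all_boot all_order all_algebra.
From mathcomp Require Import spectral complex ring.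
From mathcomp Require Import all_classical all_reals all_analysis.

Set Implicit Arguments.
Unset Strict Implicit.
Unset Printing Implicit Defensive.

Import Order.TTheory GRing.Theory Num.Theory.

Local Open Scope classical_set_scope.
Local Open Scope ring_scope.

(** * Explicit 3 by 3 matrices over a ring *)

Lemma sum3 (V : nmodType) (f : 'I_3 -> V) : \sum_k f k = f 0 + f 1 + f 2.
Proof.
rewrite !big_ord_recl big_ord0 addr0 addrA.
by congr (f _ + f _ + f _); apply: val_inj.
Qed.

Lemma mx3P (K : nzRingType) (A B : 'M[K]_3) :
  A 0 0 = B 0 0 -> A 0 1 = B 0 1 -> A 0 2 = B 0 2 ->
  A 1 0 = B 1 0 -> A 1 1 = B 1 1 -> A 1 2 = B 1 2 ->
  A 2 0 = B 2 0 -> A 2 1 = B 2 1 -> A 2 2 = B 2 2 -> A = B.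
Proof.
move=> h00 h01 h02 h10 h11 h12 h20 h21 h22.
have ord3 (i : 'I_3) : [\/ i = 0, i = 1 | i = 2].
  case: i => [[|[|[|//]]] hi];
    [constructor 1|constructor 2|constructor 3]; exact: val_inj.
by apply/matrixP => i j; case: (ord3 i) => ->; case: (ord3 j) => ->.
Qed.

Lemma mulmx3 (K : nzRingType)
    (a b c d e f g h k a' b' c' d' e' f' g' h' k' : K) :
  mx3 [:: [:: a; b; c]; [:: d; e; f]; [:: g; h; k]] *m
  mx3 [:: [:: a'; b'; c']; [:: d'; e'; f']; [:: g'; h'; k']] =
  mx3 [:: [:: a * a' + b * d' + c * g'; a * b' + b * e' + c * h';
              a * c' + b * f' + c * k'];
          [:: d * a' + e * d' + f * g'; d * b' + e * e' + f * h';
              d * c' + e * f' + f * k'];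
          [:: g * a' + h * d' + k * g'; g * b' + h * e' + k * h';
              g * c' + h * f' + k * k']].
Proof. by apply: mx3P; rewrite !mxE sum3 !mxE. Qed.

Lemma mx3_eta (K : nzRingType) (A : 'M[K]_3) :
  A = mx3 [:: [:: A 0 0; A 0 1; A 0 2]; [:: A 1 0; A 1 1; A 1 2];
              [:: A 2 0; A 2 1; A 2 2]].
Proof. by apply: mx3P; rewrite !mxE. Qed.

Lemma mx3_1 (K : nzRingType) :
  1%:M = mx3 [:: [:: 1; 0; 0]; [:: 0; 1; 0]; [:: 0; 0; 1]] :> 'M[K]_3.
Proof. by apply: mx3P; rewrite !mxE. Qed.

Lemma diag3E (K : nzRingType) (a b c : K) :
  diag3 a b c = mx3 [:: [:: a; 0; 0]; [:: 0; b; 0]; [:: 0; 0; c]].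
Proof. by apply: mx3P; rewrite !mxE. Qed.

(** The outer factors model adjoints of phases and [X] rotations, with plain ring elements for
    cosines, sines and conjugated phases, so that only polynomial identities remain. [u] is the
    second column of [U] times the right-hand factor. Only the entries needed later to identify [W]
    are listed. *)
Lemma rotated_entries (K : comNzRingType) (U : 'M[K]_3)
    (x1 x2 x3 x4 x5 cb sb cg sg : K) :
  let W := mx3 [:: [:: 1; 0; 0]; [:: 0; cb; sb]; [:: 0; - sb; cb]] *m
             diag3 x1 x2 x3 *m U *m (diag3 1 x4 x5 *m
           mx3 [:: [:: 1; 0; 0]; [:: 0; cg; sg]; [:: 0; - sg; cg]]) in
  let u i := x4 * cg * U i 1 - x5 * sg * U i 2 in
  [/\ W 0 0 = x1 * U 0 0, W 0 1 = x1 * u 0,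
      W 0 2 = x1 * (x4 * sg * U 0 1 + x5 * cg * U 0 2),
      W 1 0 = x2 * cb * U 1 0 + x3 * sb * U 2 0 &
      [/\ W 2 0 = x3 * cb * U 2 0 - x2 * sb * U 1 0,
          W 1 1 = x2 * cb * u 1 + x3 * sb * u 2 &
          W 2 1 = x3 * cb * u 2 - x2 * sb * u 1]].
Proof.
rewrite /= !diag3E (mx3_eta U) !mulmx3 !mxE /=.
by split; [ring|ring|ring|ring|split; ring].
Qed.

(** * Unitary 3 by 3 matrices with prescribed entries *)

Section Unitary3.
Variable C : numClosedFieldType.
Local Open Scope sesquilinear_scope.

Lemma adjmx3 (a b c d e f g h k : C) :
  (mx3 [:: [:: a; b; c]; [:: d; e; f]; [:: g; h; k]])^t* =
  mx3 [:: [:: a^*; d^*; g^*]; [:: b^*; e^*; h^*]; [:: c^*; f^*; k^*]].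
Proof. by apply: mx3P; rewrite !mxE. Qed.

Lemma unitarymx3_row (U : 'M[C]_3) i j : U \is unitarymx ->
  U i 0 * (U j 0)^* + U i 1 * (U j 1)^* + U i 2 * (U j 2)^* = (i == j)%:R.
Proof. by move=> /unitarymxP/matrixP/(_ i j); rewrite !mxE sum3 !mxE. Qed.

Lemma unitarymx3_col (U : 'M[C]_3) i j : U \is unitarymx ->
  U 0 i * (U 0 j)^* + U 1 i * (U 1 j)^* + U 2 i * (U 2 j)^* = (i == j)%:R.
Proof.
by rewrite -trmx_unitary => /unitarymx3_row -/(_ i j); rewrite !mxE.
Qed.

Lemma adj_diag3 (a b c : C) : (diag3 a b c)^t* = diag3 a^* b^* c^*.
Proof. by rewrite !diag3E adjmx3 !rmorph0. Qed.

Lemma diag3_unitary (a b c : C) : `|a| = 1 -> `|b| = 1 -> `|c| = 1 ->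
  diag3 a b c \is unitarymx.
Proof.
move=> na nb nc; apply/unitarymxP; rewrite diag3E adjmx3 mulmx3 mx3_1.
by rewrite !rmorph0 -!normCK na nb nc; apply: mx3P; rewrite !mxE /=; ring.
Qed.

(** Orthogonality to the first row or first column gives [s * W 1 2 = 0], [s * W 2 1 = 0] and
    [s * (c - W 2 2) = 0]; each time [s] cancels. The norm of the middle row then gives the modulus
    of [W 1 1]. *)
Lemma unitarymx3_corner (W : 'M[C]_3) (c s : C) :
    W \is unitarymx -> c^* = c -> s^* = s -> s != 0 ->
    W 0 0 = c -> W 0 1 = 0 -> W 0 2 = - s -> W 1 0 = 0 -> W 2 0 = s ->
  W = mx3 [:: [:: c; 0; - s]; [:: 0; W 1 1; 0]; [:: s; 0; c]] /\ `|W 1 1| = 1.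
Proof.
move=> Wu cE sE s0 W00 W01 W02 W10 W20.
have W12 : W 1 2 = 0.
  have := unitarymx3_row 1 0 Wu; rewrite W10 W01 W02 rmorph0 rmorphN /= sE.
  rewrite mul0r mulr0 !add0r mulrN => /eqP.
  by rewrite oppr_eq0 mulf_eq0 (negPf s0) orbF => /eqP.
have W21 : W 2 1 = 0.
  have := unitarymx3_col 1 0 Wu; rewrite W10 W01 W20 rmorph0 /= sE.
  rewrite mul0r mulr0 !add0r => /eqP.
  by rewrite mulf_eq0 (negPf s0) orbF => /eqP.
have W22 : W 2 2 = c.
  have := unitarymx3_row 2 0 Wu; rewrite W20 W21 W00 W02 rmorphN /= sE cE.
  rewrite mul0r addr0 mulrN mulrC -mulrBl => /eqP.
  by rewrite mulf_eq0 (negPf s0) orbF subr_eq0 => /eqP.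
split; first by apply: mx3P; rewrite !mxE.
apply/eqP; rewrite -sqrp_eq1 // normCK.
by have := unitarymx3_row 1 1 Wu; rewrite W10 W12 !mul0r addr0 add0r => ->.
Qed.

(** The entry [W 1 1 = 1] already exhausts the norm of the middle row, so [W 1 2 = 0]; the last row
    then has [W 2 2] as its only nonzero entry. *)
Lemma unitarymx3_block1 (W : 'M[C]_3) :
    W \is unitarymx -> W 0 0 = 1 -> W 0 1 = 0 -> W 0 2 = 0 -> W 1 0 = 0 ->
    W 1 1 = 1 -> W 2 0 = 0 -> W 2 1 = 0 ->
  W = diag3 1 1 (W 2 2) /\ `|W 2 2| = 1.
Proof.
move=> Wu W00 W01 W02 W10 W11 W20 W21.
have W12 : W 1 2 = 0.
  have /eqP := unitarymx3_row 1 1 Wu.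
  rewrite W10 W11 mul0r add0r rmorph1 mulr1 /= -subr_eq0 addrAC subrr add0r.
  by rewrite -normCK sqrf_eq0 normr_eq0 => /eqP.
split; first by rewrite diag3E; apply: mx3P; rewrite !mxE.
apply/eqP; rewrite -sqrp_eq1 // normCK.
by have := unitarymx3_row 2 2 Wu; rewrite W20 W21 !mul0r !add0r => ->.
Qed.

Lemma unitarymx_sandwich n (P U Q : 'M[C]_n) :
    P \is unitarymx -> U \is unitarymx -> Q \is unitarymx ->
  exists W, [/\ W \is unitarymx, U = P *m W *m Q & W = P^t* *m U *m Q^t*].
Proof.
move=> Pu Uu Qu; exists (P^t* *m U *m Q^t*); split=> //.
  by rewrite !mul_unitarymx ?trmxC_unitary.
by rewrite !mulmxA (unitarymxP Pu) mul1mx mulmxKtV.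
Qed.

End Unitary3.

(** * Angles, phases and unitarity of the rotations *)

Section Rotations.
Variable R : realType.
Implicit Types (x y r phi : R) (p q z : R[i]).
Local Open Scope complex_scope.
Local Open Scope sesquilinear_scope.

Lemma conj_realC x : (x%:C)^*%R = x%:C.
Proof. exact: conjc_real. Qed.

(** Oriented to eliminate squared cosines when passed to [ring]. *)
Lemma sqr_cosC phi :
  (cos phi)%:C * (cos phi)%:C = 1 - (sin phi)%:C * (sin phi)%:C.
Proof.
apply/eqP; rewrite eq_sym subr_eq -!rmorphM -rmorphD /=.
by rewrite -!expr2 cos2Dsin2.
Qed.

(** The angle [acos x] has sine [|y|]; when [y] is negative it is reflected to [2 * pi - acos x]. *)
Lemma angle_exists x y : x ^+ 2 + y ^+ 2 = 1 ->
  exists2 phi, phi \in `[0, 2 * pi] & cos phi = x /\ sin phi = y.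
Proof.
move=> xy1; have x1 : -1 <= x <= 1.
  rewrite -ler_norml -(@expr_le1 _ 2) // real_normK ?num_real // -xy1.
  by rewrite lerDl sqr_ge0.
have yE : Num.sqrt (1 - x ^+ 2) = `|y|.
  by rewrite -xy1 addrAC subrr add0r sqrtr_sqr.
have p0 := @pi_ge0 R; have a0 := acos_ge0 x1; have api := acos_lepi x1.
have [y0|y0] := leP 0 y.
  exists (acos x).
    by rewrite in_itv /= a0 (le_trans api) // mulr_natl mulr2n lerDl.
  by rewrite acosK ?in_itv // sin_acos // yE ger0_norm.
exists (pi *+ 2 - acos x).
  rewrite mulr_natl in_itv /= gerBl a0 andbT subr_ge0 (le_trans api) //.
  by rewrite mulr2n lerDl.
rewrite addrC cosD2pi sinD2pi cosN sinN acosK ?in_itv // sin_acos // yE.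
by rewrite ltr0_norm // opprK.
Qed.

Lemma phase_exists z : exists2 l, circle R l & exists x, z = l * x%:C.
Proof.
have [->|z0] := eqVneq z 0.
  by exists 1; [exact: normr1|exists 0; rewrite mulr0].
exists (z / `|z|).
  by rewrite /circle /= normrM normfV normr_id divff ?normr_eq0.
by exists (ComplexField.Normc.normc z); rewrite divfK // normr_eq0.
Qed.

Lemma circle_conjr z : circle R z -> z * z^*%R = 1.
Proof. by move=> z1; rewrite -normCK z1 expr1n. Qed.

Lemma itv_0_2pi : (0 : R) \in `[0, 2 * pi].
Proof. by rewrite in_itv /= lexx mulr_ge0 // pi_ge0. Qed.

(** Stripping phases from [p] and [q] leaves real numbers with [x ^+ 2 + y ^+ 2 = r ^+ 2], and the
    angle is that of the point [(x / r, y / r)]. *)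
Lemma polar_pair p q r : p * p^*%R + q * q^*%R = r%:C * r%:C ->
  exists phi l l', [/\ phi \in `[0, 2 * pi], circle R l, circle R l',
    p = l * (r * cos phi)%:C & q = l' * (r * sin phi)%:C].
Proof.
have [l l1 [x ->]] := phase_exists p; have [l' l'1 [y ->]] := phase_exists q.
rewrite !rmorphM /= !conj_realC => xyr.
have {xyr}xyr : x ^+ 2 + y ^+ 2 = r ^+ 2.
  apply: (@complexI R); rewrite rmorphD !rmorphXn /= [RHS]expr2 -xyr.
  ring: (circle_conjr l1) (circle_conjr l'1).
(* For [r = 0] both [p] and [q] vanish and any angle would do. *)
have [r0|r0] := eqVneq r 0.
  move/eqP: xyr; rewrite r0 expr0n paddr_eq0 ?sqr_ge0 // !sqrf_eq0.
  move=> /andP[/eqP -> /eqP ->]; exists 0, l, l'; split => //.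
  - exact: itv_0_2pi.
  - by rewrite mul0r.
  - by rewrite mul0r.
have [|phi phiI [cE sE]] := @angle_exists (x / r) (y / r).
  by rewrite !expr_div_n -mulrDl xyr divff // expf_neq0.
exists phi, l, l'; split => //.
  by rewrite cE mulrCA divff // mulr1.
by rewrite sE mulrCA divff // mulr1.
Qed.

Lemma adj_rotX phi : (rotX phi)^t* =
  mx3 [:: [:: 1; 0; 0]; [:: 0; (cos phi)%:C; (sin phi)%:C];
          [:: 0; - (sin phi)%:C; (cos phi)%:C]].
Proof. by rewrite adjmx3 !rmorphN rmorph0 rmorph1 /= !conj_realC. Qed.

Lemma rotX_unitary phi : rotX phi \is unitarymx.
Proof.
apply/unitarymxP; rewrite adjmx3 mulmx3 mx3_1 !rmorphN rmorph0 rmorph1 /=.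
rewrite !conj_realC; apply: mx3P; rewrite !mxE /=; ring: (sqr_cosC phi).
Qed.

Lemma rotY_unitary z phi : circle R z -> rotY z phi \is unitarymx.
Proof.
move=> /circle_conjr z1.
apply/unitarymxP; rewrite adjmx3 mulmx3 mx3_1 !rmorphN rmorph0 /=.
rewrite !conj_realC; apply: mx3P; rewrite !mxE /=; ring: (sqr_cosC phi) z1.
Qed.

Lemma rotZ_unitary phi : rotZ phi \is unitarymx.
Proof.
apply/unitarymxP; rewrite adjmx3 mulmx3 mx3_1 !rmorphN rmorph0 rmorph1 /=.
rewrite !conj_realC; apply: mx3P; rewrite !mxE /=; ring: (sqr_cosC phi).
Qed.

(** The left rotation is a parameter so that both descriptions share the inclusion into the unitary
    group. *)
Definition phase_rotation_product (rot : R -> 'M[R[i]]_3) (A : 'M[R[i]]_3) :=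
  exists (alpha beta gamma : R) (z l1 l2 l3 l4 l5 : R[i]),
    [/\ alpha \in `[0, 2 * pi], beta \in `[0, 2 * pi],
        gamma \in `[0, 2 * pi],
        [/\ circle R z, circle R l1, circle R l2 &
            [/\ circle R l3, circle R l4 & circle R l5]] &
        A = diag3 l1 l2 l3 *m rot beta *m rotY z alpha *m rotX gamma
              *m diag3 1 l4 l5].

Lemma phase_rotation_unitary (rot : R -> 'M[R[i]]_3) A :
    (forall phi, rot phi \is unitarymx) ->
  phase_rotation_product rot A -> A \is unitarymx.
Proof.
move=> rotu [a [b [g [z [l1 [l2 [l3 [l4 [l5 [_ _ _]]]]]]]]]].
move=> [z1 l11 l21 [l31 l41 l51]] ->.
by rewrite !mul_unitarymx ?diag3_unitary ?rotX_unitary ?rotY_unitary ?normr1.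
Qed.

Lemma circleM z z' : circle R z -> circle R z' -> circle R (z * z').
Proof. by rewrite /circle /= normrM => -> ->; rewrite mulr1. Qed.

Lemma circle_conj z : circle R z -> circle R z^*%R.
Proof. by rewrite /circle /= norm_conjC. Qed.

Lemma circleN z : circle R z -> circle R (- z).
Proof. by rewrite /circle /= normrN. Qed.

Lemma circle1 : circle R 1. Proof. exact: normr1. Qed.

(** Here [W] is [U] multiplied by the adjoints of the outer factors, whence the conjugated phases.
    It serves for both cases, [sin alpha] zero or not, with different phases and angles. *)
Lemma rotX_reduction (U : 'M[R[i]]_3) (l1 l2 l3 l4 l5 : R[i]) beta gamma :
    U \is unitarymx -> circle R l1 -> circle R l2 -> circle R l3 ->
    circle R l4 -> circle R l5 ->
  let u i := l4^*%R * (cos gamma)%:C * U i 1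
             - l5^*%R * (sin gamma)%:C * U i 2 in
  exists W : 'M[R[i]]_3, [/\ W \is unitarymx,
    U = diag3 l1 l2 l3 *m rotX beta *m W *m (rotX gamma *m diag3 1 l4 l5) &
    [/\ W 0 0 = l1^*%R * U 0 0, W 0 1 = l1^*%R * u 0,
        W 0 2 = l1^*%R * (l4^*%R * (sin gamma)%:C * U 0 1
                          + l5^*%R * (cos gamma)%:C * U 0 2),
        W 1 0 = l2^*%R * (cos beta)%:C * U 1 0
                + l3^*%R * (sin beta)%:C * U 2 0 &
        [/\ W 2 0 = l3^*%R * (cos beta)%:C * U 2 0
                    - l2^*%R * (sin beta)%:C * U 1 0,
            W 1 1 = l2^*%R * (cos beta)%:C * u 1
                    + l3^*%R * (sin beta)%:C * u 2 &
            W 2 1 = l3^*%R * (cos beta)%:C * u 2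
                    - l2^*%R * (sin beta)%:C * u 1]]].
Proof.
move=> Uu l11 l21 l31 l41 l51 u.
have Pu : diag3 l1 l2 l3 *m rotX beta \is unitarymx.
  by apply: mul_unitarymx; [apply: diag3_unitary|apply: rotX_unitary].
have Qu : rotX gamma *m diag3 1 l4 l5 \is unitarymx.
  apply: mul_unitarymx; first exact: rotX_unitary.
  by apply: diag3_unitary => //; apply: normr1.
have [W [Wu UE WE]] := unitarymx_sandwich Pu Uu Qu.
exists W; split=> //; rewrite {}WE.
rewrite !trmx_mul !map_mxM !adj_rotX !adj_diag3 rmorph1.
exact: rotated_entries.
Qed.

(** * Factorization with [rotX] on the left *)

Lemma unitary_rotX_product U :
  U \is unitarymx -> phase_rotation_product (@rotX R) U.
Proof.
move=> Uu.
have row0 := unitarymx3_row 0 0 Uu; have col0 := unitarymx3_col 0 0 Uu.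
have [l1 l11 [x U00]] := phase_exists (U 0 0).
have x1 : 0 <= 1 - x ^+ 2.
  rewrite -ler0c rmorphB rmorphXn rmorph1 /= expr2.
  have -> : 1 - x%:C * x%:C = U 0 1 * (U 0 1)^*%R + U 0 2 * (U 0 2)^*%R.
    rewrite -[1 in LHS]row0 /= U00 rmorphM /= conj_realC.
    ring: (circle_conjr l11).
  by rewrite addr_ge0 // mul_conjC_ge0.
(* The remaining entries of the first row, and those of the first column, have squared moduli
   summing to [sin alpha ^+ 2], so [polar_pair] applies to both with [r = sin alpha]. *)
have [alpha alphaI [cE sE]] : exists2 phi, phi \in `[0, 2 * pi] &
    cos phi = x /\ sin phi = Num.sqrt (1 - x ^+ 2).
  by apply: angle_exists; rewrite sqr_sqrtr // addrC subrK.
have {x1 sE} cE : U 0 0 = l1 * (cos alpha)%:C by rewrite cE.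
have [gamma [m5 [m4 [gammaI m51 m41 U02 U01]]]] :
  exists phi l l', [/\ phi \in `[0, 2 * pi], circle R l, circle R l',
    U 0 2 = l * (sin alpha * cos phi)%:C &
    U 0 1 = l' * (sin alpha * sin phi)%:C].
  apply: polar_pair; apply: (addrI (U 0 0 * (U 0 0)^*%R)).
  rewrite [X in _ + X]addrC addrA row0 /= cE rmorphM /= conj_realC.
  ring: (circle_conjr l11) (sqr_cosC alpha).
have [beta [m3 [m2 [betaI m31 m21 U20 U10]]]] :
  exists phi l l', [/\ phi \in `[0, 2 * pi], circle R l, circle R l',
    U 2 0 = l * (sin alpha * cos phi)%:C &
    U 1 0 = l' * (sin alpha * sin phi)%:C].
  apply: polar_pair; apply: (addrI (U 0 0 * (U 0 0)^*%R)).
  rewrite [X in _ + X]addrC addrA col0 /= cE rmorphM /= conj_realC.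
  ring: (circle_conjr l11) (sqr_cosC alpha).
move: U02 U01 U20 U10; rewrite !rmorphM /= => U02 U01 U20 U10.
have [s0|s0] := eqVneq (sin alpha) 0; last first.
  (* Read off from the intended product: its entries there carry the phases [- l1 l4], [- l1 l5] and
     [- l2], which must equal [m4], [m5] and [m2]. *)
  pose l2 := - m2; pose l4 := - m4 * l1^*%R; pose l5 := - m5 * l1^*%R.
  have l21 : circle R l2 by apply: circleN.
  have l41 : circle R l4 by apply: circleM; [apply: circleN|apply: circle_conj].
  have l51 : circle R l5 by apply: circleM; [apply: circleN|apply: circle_conj].
  have [W [Wu UE]] := rotX_reduction beta gamma Uu l11 l21 m31 l41 l51.
  have c1 := circle_conjr l11; have c2 := circle_conjr m21.
  have c3 := circle_conjr m31; have c4 := circle_conjr m41.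
  have c5 := circle_conjr m51.
  have cb := sqr_cosC beta; have cg := sqr_cosC gamma.
  rewrite cE U01 U02 U10 U20 => -[W00 W01 W02 W10 [W20 _ _]].
  have [||||||||WE Wc] :=
    @unitarymx3_corner _ W (cos alpha)%:C (sin alpha)%:C Wu.
  - exact: conj_realC.
  - exact: conj_realC.
  - by rewrite fmorph_eq0.
  - by rewrite W00; ring: c1.
  - rewrite W01 /l4 /l5 !rmorphM !rmorphN /= conjCK; ring: c1 c4 c5.
  - rewrite W02 /l4 /l5 !rmorphM !rmorphN /= conjCK; ring: c1 c4 c5 cg.
  - rewrite W10 /l2 rmorphN; ring: c2 c3.
  - rewrite W20 /l2 rmorphN; ring: c2 c3 cb.
  exists alpha, beta, gamma, (W 1 1), l1, l2, m3, l4, l5; split => //.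
  by rewrite UE {1}(WE : W = rotY (W 1 1) alpha) !mulmxA.
(* Now the first row and column vanish off the diagonal. The phase [l1] becomes [U 0 0] itself,
   absorbing the sign of [cos alpha], so the new angles [alpha] and [gamma] can both be 0. *)
have {}s0 : (sin alpha)%:C = 0 by rewrite s0.
move: U02 U01 U20 U10; rewrite s0 !mul0r !mulr0 => U02 U01 U20 U10.
have U00n : U 0 0 * (U 0 0)^*%R = 1.
  by move: row0; rewrite U01 U02 !mul0r !addr0.
(* The lower part of the second column is a unit vector; its polar form gives the rotation taking it
   to the second basis vector. *)
have [b [l2 [l3 [bI l21 l31 U11 U21]]]] :
  exists phi l l', [/\ phi \in `[0, 2 * pi], circle R l, circle R l',
    U 1 1 = l * (1 * cos phi)%:C & U 2 1 = l' * (1 * sin phi)%:C].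
  apply: polar_pair; rewrite rmorph1 mulr1.
  by have := unitarymx3_col 1 1 Uu; rewrite U01 mul0r add0r.
move: U11 U21; rewrite !mul1r => U11 U21.
have {}l11 : circle R (U 0 0).
  by apply/eqP; rewrite -sqrp_eq1 // normCK U00n.
have [W [Wu UE]] := rotX_reduction b 0 Uu l11 l21 l31 circle1 circle1.
rewrite cos0 sin0 U01 U02 U10 U20 U11 U21 => -[W00 W01 W02 W10 [W20 W11 W21]].
have cl2 := circle_conjr l21; have cl3 := circle_conjr l31.
have cb := sqr_cosC b.
have [|||||||WE Wc] := unitarymx3_block1 Wu.
- by rewrite W00 mulrC.
- by rewrite W01 !(mulr0, mul0r) subrr mulr0.
- by rewrite W02 !(mulr0, mul0r) addr0 mulr0.
- by rewrite W10 !mulr0 addr0.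
- by rewrite W11 conjC1; ring: cl2 cl3 cb.
- by rewrite W20 !mulr0 subrr.
- by rewrite W21 conjC1; ring: cl2 cl3 cb.
(* The leftover diagonal entry [W 2 2] supplies the last phase [l5]. *)
exists 0, b, 0, 1, (U 0 0), l2, l3, 1, (W 2 2).
have X0 : rotX 0 = 1%:M :> 'M[R[i]]_3.
  by rewrite mx3_1 /rotX cos0 sin0 oppr0.
have Y0 : rotY 1 0 = 1%:M :> 'M[R[i]]_3.
  by rewrite mx3_1 /rotY cos0 sin0 oppr0.
have I3 : diag3 1 1 1 = 1%:M :> 'M[R[i]]_3 by rewrite mx3_1 diag3E.
split; [exact: itv_0_2pi|exact: bI|exact: itv_0_2pi| |].
  by split => //; [exact: circle1|split => //; exact: circle1].
by rewrite {1}UE X0 Y0 I3 !mulmx1 {1}WE.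
Qed.

(** * Passage from [rotX] to [rotZ] by swapping coordinates *)

Lemma unitary_rotZ_product U :
  U \is unitarymx -> phase_rotation_product (@rotZ R) U.
Proof.
pose S : 'M[R[i]]_3 := mx3 [:: [:: 0; 0; 1]; [:: 0; 1; 0]; [:: 1; 0; 0]].
have SS : S *m S = 1%:M.
  by rewrite mulmx3 mx3_1; apply: mx3P; rewrite !mxE /=; ring.
have Su : S \is unitarymx.
  by apply/unitarymxP; rewrite adjmx3 rmorph0 rmorph1.
move=> /(mul_unitarymx Su) /unitary_rotX_product.
move=> [a [b [g [z [l1 [l2 [l3 [l4 [l5 [_ _ _]]]]]]]]]].
move=> [z1 l11 l21 [l31 l41 l51]].
move=> /(congr1 (mulmx S)); rewrite mulmxA SS mul1mx => UE.
(* This is [pi / 2 - a] modulo [2 * pi], brought back into the interval. *)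
have [a' aI [ca sa]] : exists2 phi, phi \in `[0, 2 * pi] &
    cos phi = sin a /\ sin phi = cos a.
  by apply: angle_exists; rewrite addrC cos2Dsin2.
have opp_angle x : exists2 phi, phi \in `[0, 2 * pi] &
    cos phi = cos x /\ sin phi = - sin x.
  by apply: angle_exists; rewrite sqrrN cos2Dsin2.
have [b' bI [cb sb]] := opp_angle b; have [g' gI [cg sg]] := opp_angle g.
(* Moving [S] rightwards reverses the left phases and turns [rotX b] into [rotZ b']; at [rotY] it is
   replaced by [E], which negates [g] and finally the last phase. *)
exists a', b', g', z, l3, l2, l1, l4, (- l5).
split=> //; first by split=> //; split=> //; apply: circleN.
pose E : 'M[R[i]]_3 := diag3 1 1 (-1).
have SD : S *m diag3 l1 l2 l3 = diag3 l3 l2 l1 *m S.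
  by rewrite !diag3E !mulmx3; apply: mx3P; rewrite !mxE /=; ring.
have SX : S *m rotX b = rotZ b' *m S.
  by rewrite !mulmx3 cb sb rmorphN; apply: mx3P; rewrite !mxE /=; ring.
have SY : S *m rotY z a = rotY z a' *m E.
  by rewrite /E diag3E !mulmx3 ca sa; apply: mx3P; rewrite !mxE /=; ring.
have EX : E *m rotX g = rotX g' *m E.
  rewrite /E diag3E !mulmx3 cg sg rmorphN.
  by apply: mx3P; rewrite !mxE /=; ring.
have ED : E *m diag3 1 l4 l5 = diag3 1 l4 (- l5).
  by rewrite /E !diag3E !mulmx3; apply: mx3P; rewrite !mxE /=; ring.
rewrite UE !mulmxA SD -(mulmxA _ S) SX !mulmxA -(mulmxA _ S) SY !mulmxA.
by rewrite -(mulmxA _ E) EX !mulmxA -(mulmxA _ E) ED.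
Qed.

End Rotations.

Theorem corollary6p6 (R : realType) :
  unitary_group R 3 =
    [set A : 'M[R[i]]_3 |
      exists (alpha beta gamma : R) (z l1 l2 l3 l4 l5 : R[i]),
        [/\ alpha \in `[0, 2 * pi], beta \in `[0, 2 * pi],
            gamma \in `[0, 2 * pi],
            [/\ circle R z, circle R l1, circle R l2 &
                [/\ circle R l3, circle R l4 & circle R l5]] &
            A = diag3 l1 l2 l3 *m rotX beta *m rotY z alpha *m rotX gamma
                  *m diag3 1 l4 l5]]
  /\
  unitary_group R 3 =
    [set A : 'M[R[i]]_3 |
      exists (alpha beta gamma : R) (z l1 l2 l3 l4 l5 : R[i]),
        [/\ alpha \in `[0, 2 * pi], beta \in `[0, 2 * pi],
            gamma \in `[0, 2 * pi],
            [/\ circle R z, circle R l1, circle R l2 &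
                [/\ circle R l3, circle R l4 & circle R l5]] &
            A = diag3 l1 l2 l3 *m rotZ beta *m rotY z alpha *m rotX gamma
                  *m diag3 1 l4 l5]].
Proof.
split; apply/seteqP; split => A /=.
- exact: unitary_rotX_product.
- exact: (phase_rotation_unitary (@rotX_unitary R)).
- exact: unitary_rotZ_product.
- exact: (phase_rotation_unitary (@rotZ_unitary R)).
Qed.
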